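(* Let $G$ be a countable group, let $\mu$ be a probability measure on $G$ whose support generates $G$ as a group, and let $(X,m)$ be a Lebesgue space (with $m$ a probability measure). Then the Markov chain on $(G\times X,\mu\otimes m)$ with transition probabilities $$\pi_{g,x}=\sum_{h}\mu(h)\,\delta_{gh}\otimes m \qquad (g\in G,\ x\in X)$$ has the same Poisson boundary as the random walk $(G,\mu)$, where $\otimes$ denotes the product measure.
   Context: **Random walk and path space.** For a probability measure $\mu$ on a countable group $G$ with identity $e$, the random walk $(G,\mu)$ is the Markov chain on $G$ with transition probabilities $p(g,h)=\mu(g^{-1}h)$. The measure $\mathbf{P}=\mathbf{P}_\mu$ on the path space $G^\infty$ is the image of the Bernoulli measure $\mu^{\infty}$ under the map $(h_1,h_2,\dots)\mapsto (e,x_1,x_2,\dots)$, where $x_n=h_1h_2\cdots h_n$. **Poisson boundary.** Let $S$ be the left shift on the path space. Two paths $\bar x,\bar x'$ are equivalent if there exist natural numbers $m,n$ with $S^m\bar x=S^n\bar x'$. The $\sigma$-algebra $\mathcal{A}$ corresponding to this equivalence relation (the measurable sets that are, modulo $\mathbf{P}$-null sets, unions of equivalence classes) is called the Poisson $\sigma$-algebra. By Rokhlin's theorem there exist a unique (mod $0$) measurable space $\Gamma=\Gamma(G,\mu)$ with $\sigma$-algebra $\sigma(\Gamma)$ and a measurable map $\mathbf{bnd}:G^\infty\to\Gamma$ such that $\mathcal{A}=\mathbf{bnd}^{-1}(\sigma(\Gamma))$. The space $\Gamma$ is equipped with the harmonic measure $\nu=\mathbf{bnd}(\mathbf{P})$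 (the image measure), and $(\Gamma,\nu)$ is the Poisson boundary of $(G,\mu)$ (the space of ergodic components of $S$). Two Poisson boundaries are the same if they coincide as measure spaces. **The extended chain.** The paths of the Markov chain on $(G\times X,\mu\otimes m)$ are $((x_1,\gamma_1),(x_2,\gamma_2),\dots)$ with $x_n=h_1\cdots h_n$, where $(h_n)$ are i.i.d. with law $\mu$, $(\gamma_n)$ are i.i.d. with law $m$, and the two sequences are independent; thus $(x_1,\gamma_1)$ has law $\mu\otimes m$. Its Poisson boundary is defined as follows. Let $\widetilde{\mathbf{P}}$ be the law of these paths on the path space $(G\times X)^\infty$, and let $\widetilde S$ be the left shift on $(G\times X)^\infty$. Two paths $\bar y,\bar y'$ in $(G\times X)^\infty$ are equivalent if there exist natural numbers $k,l$ with $\widetilde S^k\bar y=\widetilde S^l\bar y'$; let $\widetilde{\mathcal{A}}$ be the $\sigma$-algebra of measurable sets that are, modulo $\widetilde{\mathbf{P}}$-null sets, unions of equivalence classes. By Rokhlin's theorem there exist a unique (mod $0$) measurable space $\widetilde\Gamma$ with $\sigma$-algebra $\sigma(\widetilde\Gamma)$ and a measurable map $\widetilde{\mathbf{bnd}}:(G\times X)^\infty\to\widetilde\Gamma$ such that $\widetilde{\mathcal{A}}=\widetilde{\mathbf{bnd}}^{-1}(\sigma(\widetilde\Gamma))$. The Poisson boundary of the extended chain is $\widetilde\Gamma$ equipped with the image measure $\widetilde{\mathbf{bnd}}(\widetilde{\mathbf{P}})$. *)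

(* Defs.v *)
From HB Require Import structures.
From mathcomp Require Import all_boot all_order all_algebra.
From mathcomp Require Import all_classical all_reals all_analysis.
From mathcomp Require Import measurable_realfun.

Set Implicit Arguments.
Unset Strict Implicit.
Unset Printing Implicit Defensive.

Import Order.TTheory GRing.Theory Num.Theory.
Import numFieldNormedType.Exports.

Local Open Scope classical_set_scope.
Local Open Scope ring_scope.

Definition discrete_group (G : Type) : Type := G.

HB.instance Definition _ (G : groupType) := Group.on (discrete_group G).

HB.instance Definition _ (G : groupType) :=
  isPointed.Build (discrete_group G) (1%g : G).

HB.instance Definition _ (G : groupType) :=
  @isMeasurable.Build default_measure_display (discrete_group G)
    discrete_measurable discrete_measurable0 discrete_measurableC
    discrete_measurableU.

Definition path_space (T : Type) : Type := nat -> T.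

Definition path_display : measure_display -> measure_display.
Proof. exact. Qed.

Section path_measurableType.
Context d (T : measurableType d).

HB.instance Definition _ := gen_eqMixin (path_space T).
HB.instance Definition _ := gen_choiceMixin (path_space T).
HB.instance Definition _ := isPointed.Build (path_space T) (fun=> point).

Definition path_measurable : set (set (path_space T)) :=
  <<s \bigcup_n preimage_set_system setT (fun x : path_space T => x n) measurable >>.

Let path0 : path_measurable set0. Proof. exact: sigma_algebra0. Qed.
Let pathC A : path_measurable A -> path_measurable (~` A).
Proof. exact: sigma_algebraC. Qed.
Let pathU (F : (set (path_space T))^nat) :
  (forall i, path_measurable (F i)) -> path_measurable (\bigcup_i F i).
Proof. exact: sigma_algebra_bigcup. Qed.

HB.instance Definition _ := @isMeasurable.Build (path_display d)
  (path_space T) path_measurable path0 pathC pathU.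

End path_measurableType.

Section mod0.
Context (R : realType).

(* Measurability with respect to the mu-completion of the sigma-algebra. *)
Definition measurable_mod0 d (T : measurableType d) (mu : set T -> \bar R)
    (A : set T) : Prop :=
  exists2 B, measurable B & mu.-negligible (A `+` B).

(* [f] is measurable and measure preserving for the completions. *)
Definition measure_preserving_mod0 d1 d2 (T1 : measurableType d1)
    (T2 : measurableType d2) (mu1 : set T1 -> \bar R) (mu2 : set T2 -> \bar R)
    (f : T1 -> T2) : Prop :=
  forall C, measurable C -> exists B,
    [/\ measurable B, mu1.-negligible (f @^-1` C `+` B) & mu1 B = mu2 C].

(* The sets {x | g (f x) = x} and {y | f (g y) = y} have full measure, and [f]
   and [g] restrict to mutually inverse bijections between them. *)
Definition isomorphic_mod0 d1 d2 (T1 : measurableType d1)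
    (T2 : measurableType d2) (mu1 : {measure set T1 -> \bar R})
    (mu2 : {measure set T2 -> \bar R}) : Prop :=
  exists (f : T1 -> T2) (g : T2 -> T1),
    [/\ measure_preserving_mod0 mu1 mu2 f, measure_preserving_mod0 mu2 mu1 g,
        \forall x \ae mu1, g (f x) = x & \forall y \ae mu2, f (g y) = y].

(* Lebesgue measure on [0, a] plus atoms of mass [p n] at the points -(n + 1). *)
Definition interval_with_atoms (a : R) (p : nat -> {nonneg R}) :=
  measure_add (mrestr (@lebesgue_measure R) (measurable_itv `[0, a]))
    (mseries (fun n => mscale (p n) \d_(- n.+1%:R : measurableTypeR R)) 0).

Definition lebesgue_space d (T : measurableType d)
    (mu : {measure set T -> \bar R}) : Prop :=
  exists (a : R) (p : nat -> {nonneg R}),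
    isomorphic_mod0 mu (interval_with_atoms a p).

End mod0.

Section poisson_boundary.
Context d (T : measurableType d) (R : realType).

Definition path_shift (x : path_space T) : path_space T := fun n => x n.+1.

Definition path_equiv (x y : path_space T) : Prop :=
  exists m n : nat, iter m path_shift x = iter n path_shift y.

Definition union_of_classes (U : set (path_space T)) : Prop :=
  forall x y, path_equiv x y -> U x -> U y.

Variable P : set (path_space T) -> \bar R.

Definition poisson_algebra (A : set (path_space T)) : Prop :=
  measurable_mod0 P A /\
  exists2 U, union_of_classes U & P.-negligible (A `+` U).

(* [Gamma] is required to be a Lebesgue space: this is the class in which
   Rokhlin's theorem makes the quotient unique mod 0. The equality between the
   Poisson sigma-algebra and the sigma-algebra pulled back along [bnd] is an
   equality mod 0, the former containing all the P-negligible sets. *)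
Definition is_poisson_boundary d' (Gamma : measurableType d')
    (nu : {measure set Gamma -> \bar R}) (bnd : path_space T -> Gamma) : Prop :=
  [/\ lebesgue_space nu,
      measure_preserving_mod0 P nu bnd
    & forall A, poisson_algebra A <->
        exists2 C, measurable C & P.-negligible (A `+` bnd @^-1` C)].

End poisson_boundary.

Section chains.
Local Open Scope ereal_scope.
Context (R : realType).

Definition bernoulli_measure d (T : measurableType d) (m : probability T R)
    (B : probability (path_space T) R) : Prop :=
  forall (n : nat) (A : nat -> set T), (forall i, measurable (A i)) ->
    B [set x | forall i, (i < n)%N -> A i (x i)] = \prod_(i < n) m (A i).

Definition markov_chain_law d (T : measurableType d)
    (init : set T -> \bar R) (kernel : T -> set T -> \bar R)
    (P : probability (path_space T) R) : Prop :=
  (forall A, measurable A -> P [set x | A (x 0%N)] = init A) /\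
  forall (n : nat) (A : nat -> set T), (forall i, measurable (A i)) ->
    P [set x | forall i, (i <= n.+1)%N -> A i (x i)] =
    \int[P]_(x in [set x | forall i, (i <= n)%N -> A i (x i)])
      kernel (x n) (A n.+1).

Variable G : groupType.

Definition generates (S : set G) : Prop :=
  forall H : {pred G}, group_closed H ->
    (forall g, S g -> g \in H) -> forall g, g \in H.

Definition mu_support (mu : probability (discrete_group G) R) : set G :=
  [set g | mu [set g] != 0].

(* [walk h] is (e, x_1, x_2, ...) with x_n = h_1 ... h_n, where h_n is [h n.-1]. *)
Fixpoint walk (h : path_space (discrete_group G)) (n : nat) : discrete_group G :=
  if n is k.+1 then (walk h k * h k)%g else 1%g.

Definition random_walk_law (mu : probability (discrete_group G) R)
    (P : probability (path_space (discrete_group G)) R) : Prop :=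
  exists2 B, bernoulli_measure mu B &
    forall A, measurable A -> P A = B ((walk : path_space _ -> path_space _) @^-1` A).

Definition extended_kernel d (X : measurableType d)
    (mu : probability (discrete_group G) R) (m : probability X R)
    (y : discrete_group G * X) (A : set (discrete_group G * X)) : \bar R :=
  \esum_(h in [set: discrete_group G])
    (mu [set h] * (\d_((y.1 * h)%g : discrete_group G) \x m) A).

(* If [w] is an i.i.d. sequence of pairs (h_n, gamma_n) with law mu \x m, its
   image is the path ((x_1, gamma_1), (x_2, gamma_2), ...); the law of this
   image is [markov_chain_law (mu \x m) (extended_kernel mu m)], as shown by
   [markov_chain_law_extended] below. *)
Definition extended_path d (X : measurableType d)
    (w : path_space (discrete_group G * X)%type) :
    path_space (discrete_group G * X)%type :=
  fun n => (walk (fun i => (w i).1) n.+1, (w n).2).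

End chains.

Section path_measurability.
Context d (T : measurableType d).

Definition cylinder n (A : nat -> set T) : set (path_space T) :=
  [set x | forall i, (i < n)%N -> A i (x i)].

Definition cylinders : set (set (path_space T)) :=
  [set cylinder nA.1 nA.2 | nA in [set nA : nat * (nat -> set T) |
     forall i, measurable (nA.2 i)]].

Lemma measurable_coord n : measurable_fun setT (fun x : path_space T => x n).
Proof.
move=> _ A mA; apply: sub_sigma_algebra; exists n => //; by exists A.
Qed.

Lemma measurable_path d' (S : measurableType d') (f : S -> path_space T) :
  (forall n, measurable_fun setT (fun y => f y n)) -> measurable_fun setT f.
Proof.
move=> mf.
apply: (@measurability _ _ _ _ setT f
  (\bigcup_n preimage_set_system setT (fun x : path_space T => x n) measurable)).
  by [].
move=> _ [_ [n _ [A mA <-]] <-]; rewrite !setTI.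
by have := mf n measurableT _ mA; rewrite setTI.
Qed.

Lemma cylinderE n A :
  cylinder n A = \bigcap_(i in `I_n) ((fun x : path_space T => x i) @^-1` A i).
Proof. by apply/seteqP; split => x /=. Qed.

Lemma measurable_cylinder n A : (forall i, measurable (A i)) ->
  measurable (cylinder n A).
Proof.
move=> mA; rewrite cylinderE; apply: fin_bigcap_measurable => [|i _]; first exact: finite_II.
by rewrite -[X in measurable X]setTI; exact: measurable_coord.
Qed.

Lemma setI_closed_cylinders : setI_closed cylinders.
Proof.
move=> _ _ [[n A] /= mA <-] [[k B] /= mB <-].
pose C i := (if (i < n)%N then A i else setT) `&` (if (i < k)%N then B i else setT).
exists (maxn n k, C) => /=.
  by move=> i; apply: measurableI; case: ifP.
apply/seteqP; split => x.
  move=> xC; split => i /= ilt; have := xC i; rewrite leq_max ilt ?orbT /C /= ilt => /(_ isT) [] //.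
by move=> [xA xB] i /= _; split; case: ifP => // ?; [exact: xA|exact: xB].
Qed.

Lemma measurable_cylindersE : @measurable _ (path_space T) = <<s cylinders >>.
Proof.
apply/seteqP; split.
  apply: smallest_sub; first exact: smallest_sigma_algebra.
  move=> _ [n _ [A mA <-]]; apply: sub_sigma_algebra.
  exists (n.+1, fun i => if i == n then A else setT) => /=.
    by move=> i; case: ifP.
  rewrite setTI; apply/seteqP; split => x /=; rewrite /cylinder /=.
    by move=> /(_ n (ltnSn n)); rewrite eqxx.
  by move=> Ax i _; case: eqP => // ->.
apply: smallest_sub; first exact: sigma_algebra_measurable.
by move=> _ [[n A] /= mA <-]; exact: measurable_cylinder.
Qed.

Lemma path_measure_unique (R : realType) (P Q : probability (path_space T) R) :
  (forall n A, (forall i, measurable (A i)) -> P (cylinder n.+1 A) = Q (cylinder n.+1 A)) ->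
  forall A, measurable A -> P A = Q A.
Proof.
move=> PQ; apply: (measure_unique cylinders (fun=> setT)).
- exact: measurable_cylindersE.
- exact: setI_closed_cylinders.
- move=> _; exists (0%N, fun=> setT) => //=.
  by apply/seteqP; split.
- by apply/seteqP; split => // x _; exists 0%N.
- move=> _ [[[|n] A] /= mA <-]; last exact: PQ.
  rewrite (_ : cylinder 0 A = setT) ?probability_setT//.
  by apply/seteqP; split.
- by move=> _ /=; rewrite probability_setT ltry.
Qed.

End path_measurability.

Section resample.
Local Open Scope ereal_scope.
Context d (T : measurableType d) (R : realType).
Variables (m : probability T R) (B : probability (path_space T) R).
Hypothesis Bm : bernoulli_measure m B.

Definition path_update (k : nat) (p : (path_space T * T)%type) : path_space T :=
  fun i => if i == k then p.2 else p.1 i.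

Lemma measurable_path_update k : measurable_fun setT (path_update k).
Proof.
apply: measurable_path => n; rewrite /path_update; case: eqP => _.
  exact: measurable_snd.
exact: measurableT_comp (measurable_coord n) measurable_fst.
Qed.

Lemma bernoulli_resample k F : measurable F ->
  B F = \int[B]_w m [set t | F (path_update k (w, t))].
Proof.
move=> mF.
pose U : {mfun (path_space T * T)%type >-> path_space T} :=
  mfun_Sub (mem_set (@measurable_path_update k)).
transitivity (distribution (B \x m) U F); last first.
  by apply: eq_integral => w _; congr (m _); apply/seteqP; split => t;
    rewrite /xsection /= inE.
apply: path_measure_unique => // n A mA.
rewrite [LHS]Bm//.
pose A' i := if i == k then setT else A i.
transitivity ((B \x m) (cylinder n.+1 A' `*` (if (k < n.+1)%N then A k else setT))); last first.
  congr ((B \x m) _); apply/seteqP; split => -[w t] /=; last first.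
    move=> wt; split; last by case: ifP => // /wt; rewrite /U/= /path_update eqxx.
    move=> i /wt; rewrite /U/= /path_update/A'; case: eqP => //.
  move=> [wA tA] i ilt; move: (wA i ilt) tA; rewrite /U/= /path_update/A'.
  by case: eqP => // <- _; rewrite ilt.
have mA' i : measurable (A' i) by rewrite /A'; case: eqP.
have mI : measurable (if (k < n.+1)%N then A k else setT) by case: ifP.
transitivity (B (cylinder n.+1 A') * m (if (k < n.+1)%N then A k else setT));
  last exact/esym/(product_measure1E _ _ (measurable_cylinder n.+1 mA') mI).
have BA := Bm n.+1 mA'; rewrite -/(cylinder n.+1 A') in BA.
rewrite BA; case: ltnP => kn.
  rewrite (bigD1 (Ordinal kn))//= [in RHS](bigD1 (Ordinal kn))//=.
  rewrite /A' eqxx probability_setT mul1e muleC; congr (_ * _).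
  by apply: eq_bigr => i; rewrite -val_eqE /= => /negbTE ->.
rewrite probability_setT mule1; apply: eq_bigr => i _; rewrite /A'.
by rewrite ltn_eqF// (leq_trans _ kn).
Qed.

End resample.

Section countable_group.
Local Open Scope ereal_scope.
Variable G : groupType.
Hypothesis Gc : countable [set: G].
Local Notation dG := (discrete_group G).

Lemma measurable_mulg d (S : measurableType d) (f g : S -> dG) :
  measurable_fun setT f -> measurable_fun setT g ->
  measurable_fun setT (fun s => (f s * g s)%g : dG).
Proof.
move=> mf mg _ A mA; rewrite setTI.
rewrite (_ : _ @^-1` A = \bigcup_(a : dG) (f @^-1` [set a] `&`
   g @^-1` [set b | A (a * b)%g])); last first.
  by apply/seteqP; split => [s /= ?|s [a _ [/= -> //]]]; exists (f s).
apply: countable_bigcupT_measurable => // a; apply: measurableI.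
  by rewrite -[X in measurable X]setTI; exact: mf.
by rewrite -[X in measurable X]setTI; exact: mg.
Qed.

Lemma measurable_discrete d (S : measurableType d) (f : dG -> S) :
  measurable_fun setT f.
Proof. by move=> _ A _. Qed.

Lemma integral_discrete (R : realType) (mu : probability dG R) (f : dG -> \bar R) :
  (forall g, 0 <= f g) ->
  \int[mu]_g f g = \esum_(g in [set: dG]) (mu [set g] * f g).
Proof.
move=> f0; have /countable_injP[e einj] := Gc.
pose F n : set dG := [set g | e g = n].
have UF : \bigcup_n F n = setT by apply/seteqP; split => // g _; exists (e g).
have tF : trivIset setT F by move=> i j _ _ [g [<- <-]].
rewrite -UF ge0_integral_bigcup//.
rewrite nneseries_esumT; last by move=> n; exact: integral_ge0.
rewrite esum_bigcupT//; last by move=> g; exact: mule_ge0.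
apply: eq_esum => n _.
have [[g Fg]|nF] := pselect (exists g, F n g); last first.
  have -> : F n = set0 by apply/seteqP; split => // g Fg; apply: nF; exists g.
  by rewrite integral_set0 esum_set0.
have -> : F n = [set g].
  apply/seteqP; split => [h Fh|h -> //]; apply: einj; rewrite ?inE//.
  by rewrite Fh Fg.
rewrite esum_set1 ?mule_ge0//.
rewrite (eq_integral (cst (f g))); last by move=> x; rewrite inE => ->.
by rewrite integral_cst// muleC.
Qed.

Section kernel.
Context d (X : measurableType d) (R : realType).
Variables (mu : probability dG R) (m : probability X R).
Local Notation E := (dG * X)%type.

Definition walk_step (y : E) (ts : E) : E := ((y.1 * ts.1)%g, ts.2).

Lemma measurable_walk_step d' (S : measurableType d') (f g : S -> E) :
  measurable_fun setT f -> measurable_fun setT g ->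
  measurable_fun setT (fun s => walk_step (f s) (g s)).
Proof.
move=> mf mg; apply/measurable_fun_pairP; split => /=.
  apply: measurable_mulg.
    exact: (measurableT_comp measurable_fst mf).
  exact: (measurableT_comp measurable_fst mg).
exact: (measurableT_comp measurable_snd mg).
Qed.

Lemma extended_kernelE y A : measurable A ->
  extended_kernel mu m y A = (mu \x m) [set ts | A (walk_step y ts)].
Proof.
move=> mA; rewrite /extended_kernel -integral_discrete//.
apply: eq_integral => t _.
rewrite /= /product_measure1 integral_dirac//=.
rewrite diracT mul1e; congr (m _).
Qed.

Lemma extended_kernel_ge0 y A : 0 <= extended_kernel mu m y A.
Proof. by apply: esum_ge0 => h _; exact: mule_ge0. Qed.

Lemma measurable_extended_kernel A :
  measurable_fun setT (fun y : E => extended_kernel mu m y A : \bar R).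
Proof.
apply: (measurableT_comp (f := fun g : dG => extended_kernel mu m (g, point) A)
  _ measurable_fst).
by move=> _ ? _.
Qed.

End kernel.
End countable_group.

Section paths.
Local Open Scope ereal_scope.
Variable G : groupType.
Hypothesis Gc : countable [set: G].
Local Notation dG := (discrete_group G).
Context d (X : measurableType d) (R : realType).
Variables (mu : probability dG R) (m : probability X R).
Local Notation E := (dG * X)%type.

Local Notation extended_path := (@extended_path G d X).

Lemma extended_path0 w : extended_path w 0%N = w 0%N.
Proof. by rewrite /extended_path /= mul1g -surjective_pairing. Qed.

Lemma extended_pathS w n :
  extended_path w n.+1 = walk_step (extended_path w n) (w n.+1).
Proof. by []. Qed.

Lemma extended_path_update w n t k : (k < n)%N ->
  extended_path (path_update n (w, t)) k = extended_path w k.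
Proof.
elim: k => [|k IH] kn.
  by rewrite !extended_path0 /path_update ltn_eqF.
by rewrite !extended_pathS IH 1?ltnW// /path_update ltn_eqF.
Qed.

Lemma measurable_extended_path : measurable_fun setT extended_path.
Proof.
apply: measurable_path; elim=> [|n IH].
  rewrite (_ : (fun y => _) = (fun w : path_space E => w 0%N)).
    exact: measurable_coord.
  by apply/funext => w; exact: extended_path0.
exact: (measurable_walk_step Gc IH (measurable_coord n.+1)).
Qed.

Variable B : probability (path_space E) R.
Hypothesis Bm : bernoulli_measure (mu \x m) B.

Let Phi : {mfun path_space E >-> path_space E} :=
  mfun_Sub (mem_set measurable_extended_path).

Lemma extended_path_markov (P : probability (path_space E) R) :
  (forall A, measurable A -> P A = B (extended_path @^-1` A)) ->
  markov_chain_law (mu \x m) (extended_kernel mu m) P.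
Proof.
move=> PB; split=> [A mA|n A mA].
  rewrite PB; last first.
    by have := measurable_coord 0%N measurableT mA; rewrite setTI.
  have := Bm 1%N (fun=> mA); rewrite big_ord1 => <-; congr (B _).
  apply/seteqP; split => w /=; rewrite extended_path0.
    by move=> ? [].
  exact.
have mcyl k : measurable (cylinder k A) by exact: measurable_cylinder.
have mpre C : measurable C -> measurable (extended_path @^-1` C).
  by move=> mC; rewrite -[X in measurable X]setTI; exact: measurable_extended_path.
have kE w : [set t | cylinder n.+2 A (extended_path (path_update n.+1 (w, t)))] =
    if `[< cylinder n.+1 A (extended_path w) >]
    then [set t | A n.+1 (walk_step (extended_path w n) t)] else set0.
  case: asboolP => [wA|nwA]; apply/seteqP; split => t //=.
  - move=> /(_ n.+1 (ltnSn _)).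
    by rewrite extended_pathS extended_path_update// /path_update eqxx.
  - move=> tA i; rewrite ltnS leq_eqVlt => /orP[/eqP ->|ilt].
      by rewrite extended_pathS extended_path_update// /path_update eqxx.
    by rewrite extended_path_update//; exact: wA.
  - move=> tA; apply: nwA => i ilt; have := tA i (ltnW ilt).
    by rewrite extended_path_update.
rewrite -/(cylinder n.+2 A) -/(cylinder n.+1 A) PB//.
rewrite (bernoulli_resample Bm n.+1 (mpre _ (mcyl n.+2))).
rewrite [RHS](@eq_measure_integral _ _ _ _ (distribution B Phi)); last first.
  by move=> C mC _; exact: (PB C mC).
rewrite ge0_integral_pushforward//; last 2 first.
  apply: measurable_funTS.
  exact: (measurableT_comp (measurable_extended_kernel _ _ _) (measurable_coord n)).
  by move=> *; exact: extended_kernel_ge0.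
rewrite [RHS]integral_mkcond; apply: eq_integral => w _.
rewrite kE patchE; case: asboolP => wA.
  by rewrite mem_set//= (extended_kernelE Gc).
by rewrite memNset//= measure0.
Qed.

Lemma markov_chain_law_unique (init : set E -> \bar R) (k : E -> set E -> \bar R)
    (P Q : probability (path_space E) R) :
  (forall y A, 0 <= k y A) ->
  (forall A, measurable A -> measurable_fun setT (k ^~ A)) ->
  markov_chain_law init k P -> markov_chain_law init k Q ->
  forall A, measurable A -> P A = Q A.
Proof.
move=> k0 mk [P0 PS] [Q0 QS]; apply: path_measure_unique; elim=> [|n IH] A mA.
  have c1 : cylinder 1 A = [set x | A 0%N (x 0%N)].
    by apply/seteqP; split => x; [exact|move=> ? [|]].
  by rewrite c1 P0// Q0.
rewrite [LHS](PS n A mA) [RHS](QS n A mA).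
pose D := cylinder n.+1 A; have mD : measurable D by exact: measurable_cylinder.
pose f (x : path_space E) := x n.
have mf : measurable_fun setT f by exact: measurable_coord.
pose F : {mfun path_space E >-> E} := mfun_Sub (mem_set mf).
suff H (M : probability (path_space E) R) :
    \int[M]_(x in D) k (x n) (A n.+1) =
    \int[pushforward (mrestr M mD) F]_y k y (A n.+1).
  rewrite -/(cylinder n.+1 A) -/D !H; apply: eq_measure_integral => C mC _.
  rewrite /= /pushforward /mrestr.
  pose A' i := if i == n then A i `&` C else A i.
  have -> : F @^-1` C `&` D = cylinder n.+1 A'.
    apply/seteqP; split => x.
      by move=> [Cx Dx] i ilt; rewrite /A'; case: eqP => [->|_]; [split => //|]; exact: Dx.
    move=> xA'; split; first by have := xA' n (ltnSn _); rewrite /A' eqxx => -[].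
    by move=> i /xA'; rewrite /A'; case: eqP => [->|//] [].
  by apply: IH => i; rewrite /A'; case: ifP => // _; exact: measurableI.
rewrite ge0_integral_pushforward//; last exact: mk.
rewrite preimage_setT [RHS](@ge0_negligible_integral _ _ _ _ _ (~` D))//.
- rewrite setTD setCK; apply: eq_measure_integral => C mC CD.
  by rewrite /= /mrestr setIidl.
- exact: measurableC.
- exact: (measurableT_comp (mk _ (mA _)) mf).
- move=> *; exact: k0.
- by have := measure0 M; rewrite -(setICl D).
Qed.

Lemma markov_chain_law_extended (P : probability (path_space E) R) :
  markov_chain_law (mu \x m) (extended_kernel mu m) P <->
  forall A, measurable A -> P A = B (extended_path @^-1` A).
Proof.
split; last exact: extended_path_markov.
move=> PM A mA; apply: (markov_chain_law_unique _ _ PM _ mA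
  (Q := distribution B Phi)).
- exact: extended_kernel_ge0.
- by move=> C _; exact: measurable_extended_kernel.
- exact: extended_path_markov.
Qed.

End paths.

(* Main.v *)
Require Import Defs.
From HB Require Import structures.
From mathcomp Require Import all_boot all_order all_algebra.
From mathcomp Require Import all_classical all_reals all_analysis.
From mathcomp Require Import measurable_realfun.

(** Write Q for the law of the X-coordinates of the extended chain. It is the
Bernoulli measure of m, and the extended path space, up to null sets, is the
product of the path space of the random walk and X^oo: Pt is the image of
P \x Q under the map ([join_path]) that sends a pair (x, g) to the path
((x_1, g_0), (x_2, g_1), ...) ([extended_chain_joinE]). In the other direction,
forgetting the X-coordinates and putting the starting point e back in front
([group_path]) maps Pt to P and equivalent paths to equivalent paths.

The two Poisson sigma-algebras correspond to each other along [group_path].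
That the preimage of a Poisson set is a Poisson set is immediate. Conversely,
let U be a union of classes of extended paths. Two extended paths over the same
x whose X-coordinates differ at finitely many places are equivalent, so the
fibre of U over x is a tail event of X^oo and, by the Kolmogorov 0-1 law
([bernoulli_01]), has measure 0 or 1 for almost every x. Hence U agrees mod 0
with the preimage of the set of the x whose fibre has full measure, and this
set is itself mod 0 a union of classes, because the shift of X^oo preserves Q
and pulls back non-negligible sets to non-negligible sets
([poisson_algebra_descends]).

So bnd \o group_path and bndt generate the same sigma-algebra mod 0 on the
extended path space. Rokhlin's uniqueness theorem ([rokhlin_unique]) concludes:
two maps into Lebesgue spaces that generate the same sigma-algebra mod 0 have
isomorphic images. It reduces to real-valued maps f and g, for which f is
almost everywhere F \o g with F t the infimum of the rationals q such that t
lies in a measurable set whose preimage under g is, mod 0, the event f < q;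
exchanging f and g gives the inverse of F. *)

Set Implicit Arguments.
Unset Strict Implicit.
Unset Printing Implicit Defensive.

Import Order.TTheory GRing.Theory Num.Theory.
Import numFieldNormedType.Exports.

Local Open Scope classical_set_scope.
Local Open Scope ring_scope.

(** * Equality of sets mod 0 and maps preserving measures mod 0 *)

Section measurable_preimage.
Context d1 d2 (T1 : measurableType d1) (T2 : measurableType d2).

Lemma measurable_preimage (f : T1 -> T2) C :
  measurable_fun setT f -> measurable C -> measurable (f @^-1` C).
Proof. by move=> mf mC; rewrite -[X in measurable X]setTI; exact: mf. Qed.

End measurable_preimage.

Section eq_mod0.
Context d (T : measurableType d) (R : realType).

(** The sets [A] and [B] differ by a negligible set; neither is required to be
measurable. *)
Definition eq_mod0 (mu : set T -> \bar R) (A B : set T) : Prop :=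
  mu.-negligible (A `+` B).

Variable mu : {measure set T -> \bar R}.

Lemma eq_mod0P A B : eq_mod0 mu A B <->
  exists N, [/\ measurable N, mu N = 0%E & forall x, ~ N x -> (A x <-> B x)].
Proof.
split=> [[N [mN N0 ABN]]|[N [mN N0 AB]]]; exists N; split => //.
  move=> x Nx; split=> [Ax|Bx]; apply: contrapT => nx; apply/Nx/ABN.
    by left.
  by right.
move=> x [[Ax nBx]|[Bx nAx]]; apply: contrapT => /AB ABx.
  exact/nBx/ABx.
exact/nAx/ABx.
Qed.

Lemma eq_mod0_refl A : eq_mod0 mu A A.
Proof. by rewrite /eq_mod0 setYK; exact: negligible_set0. Qed.

Lemma eq_mod0_sym A B : eq_mod0 mu A B -> eq_mod0 mu B A.
Proof. by rewrite /eq_mod0 setYC. Qed.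

Lemma eq_mod0_trans B A C : eq_mod0 mu A B -> eq_mod0 mu B C -> eq_mod0 mu A C.
Proof.
move=> AB BC; apply: negligibleS (negligibleU AB BC).
move=> x [[Ax nCx]|[Cx nAx]]; have [Bx|nBx] := pselect (B x).
- by right; left.
- by left; left.
- by left; right.
- by right; right.
Qed.

Lemma eq_mod0_measure A B : measurable A -> measurable B ->
  eq_mod0 mu A B -> mu A = mu B.
Proof.
suff H C D : measurable C -> measurable D -> eq_mod0 mu C D -> (mu C <= mu D)%E.
  move=> mA mB AB; apply/eqP; rewrite eq_le H//=.
  by apply: H => //; exact: eq_mod0_sym.
move=> mC mD /eq_mod0P[N [mN N0 CD]].
apply: (@le_trans _ _ (mu (D `|` N))).
  apply: le_measure; rewrite ?inE//; first exact: measurableU.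
  move=> x Cx; have [Nx|nNx] := pselect (N x); [by right|left].
  exact/(CD x nNx).
by apply: le_trans (measureU2 mu mD mN) _; rewrite [X in (_ + X)%E]N0 adde0.
Qed.

End eq_mod0.

Section measure_preserving_mod0.
Context (R : realType).

Section preimage.
Context d1 d2 (T1 : measurableType d1) (T2 : measurableType d2).
Variables (mu1 : {measure set T1 -> \bar R}) (mu2 : {measure set T2 -> \bar R}).

Lemma measure_preserving_mod0_measurable (f : T1 -> T2) :
  measurable_fun setT f ->
  (forall C, measurable C -> mu1 (f @^-1` C) = mu2 C) ->
  measure_preserving_mod0 mu1 mu2 f.
Proof.
move=> mf fmu C mC; exists (f @^-1` C); split; last exact: fmu.
  exact: measurable_preimage.
exact: eq_mod0_refl.
Qed.

Lemma negligible_preimage (f : T1 -> T2) N :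
  measure_preserving_mod0 mu1 mu2 f ->
  mu2.-negligible N -> mu1.-negligible (f @^-1` N).
Proof.
move=> pf [M [mM M0 NM]]; have [B [mB fMB Bmu]] := pf M mM.
have nB : mu1.-negligible B by exists B; split => //; rewrite Bmu.
apply: negligibleS (negligibleU fMB nB) => x /NM fMx.
by have [Bx|nBx] := pselect (B x); [right|left; left].
Qed.

Lemma eq_mod0_preimage (f : T1 -> T2) A B :
  measure_preserving_mod0 mu1 mu2 f ->
  eq_mod0 mu2 A B -> eq_mod0 mu1 (f @^-1` A) (f @^-1` B).
Proof. by move=> pf AB; exact: (negligible_preimage pf AB). Qed.

Lemma measurable_mod0_preimage (f : T1 -> T2) A :
  measure_preserving_mod0 mu1 mu2 f ->
  measurable_mod0 mu2 A -> measurable_mod0 mu1 (f @^-1` A).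
Proof.
move=> pf [B mB AB]; have [D [mD BD _]] := pf B mB.
by exists D => //; apply: eq_mod0_trans BD; exact: eq_mod0_preimage AB.
Qed.

End preimage.

Lemma measure_preserving_mod0_comp d1 d2 d3 (T1 : measurableType d1)
    (T2 : measurableType d2) (T3 : measurableType d3)
    (mu1 : {measure set T1 -> \bar R}) (mu2 : {measure set T2 -> \bar R})
    (mu3 : {measure set T3 -> \bar R}) (f : T1 -> T2) (g : T2 -> T3) :
  measure_preserving_mod0 mu1 mu2 f -> measure_preserving_mod0 mu2 mu3 g ->
  measure_preserving_mod0 mu1 mu3 (g \o f).
Proof.
move=> pf pg C mC; have [B [mB gCB Bmu]] := pg C mC.
have [A [mA fBA Amu]] := pf B mB; exists A; split => //; last by rewrite Amu.
apply: eq_mod0_trans fBA.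
exact: (eq_mod0_preimage pf gCB).
Qed.

Lemma isomorphic_mod0_sym d1 d2 (T1 : measurableType d1)
    (T2 : measurableType d2) (mu1 : {measure set T1 -> \bar R})
    (mu2 : {measure set T2 -> \bar R}) :
  isomorphic_mod0 mu1 mu2 -> isomorphic_mod0 mu2 mu1.
Proof. by move=> [f [g [pf pg gf fg]]]; exists g, f; split. Qed.

Lemma isomorphic_mod0_trans d1 d2 d3 (T1 : measurableType d1)
    (T2 : measurableType d2) (T3 : measurableType d3)
    (mu1 : {measure set T1 -> \bar R}) (mu2 : {measure set T2 -> \bar R})
    (mu3 : {measure set T3 -> \bar R}) :
  isomorphic_mod0 mu1 mu2 -> isomorphic_mod0 mu2 mu3 ->
  isomorphic_mod0 mu1 mu3.
Proof.
move=> [f [g [pf pg gf fg]]] [f' [g' [pf' pg' gf' fg']]].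
exists (f' \o f), (g \o g'); split.
- exact: measure_preserving_mod0_comp pf pf'.
- exact: measure_preserving_mod0_comp pg' pg.
- apply: negligibleS (negligibleU gf (negligible_preimage pf gf')) => x /= nx.
  have [gfx|] := pselect (g (f x) = x); [right => /= gfx'|by left].
  by apply: nx; rewrite gfx'.
- apply: negligibleS (negligibleU fg' (negligible_preimage pg' fg)) => x /= nx.
  have [gfx|] := pselect (f' (g' x) = x); [right => /= gfx'|by left].
  by apply: nx; rewrite gfx'.
Qed.

End measure_preserving_mod0.

(** * Uniqueness of the quotient by a sigma-algebra *)

Section rokhlin.
Context d (T : measurableType d) (R : realType).
Variable mu : {measure set T -> \bar R}.

(** The sigma-algebra generated by [f] is contained, mod 0, in the one generated
by [g]. *)
Definition coarser_mod0 d1 d2 (T1 : measurableType d1) (T2 : measurableType d2)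
    (f : T -> T1) (g : T -> T2) : Prop :=
  forall C, measurable C ->
    exists2 D, measurable D & eq_mod0 mu (f @^-1` C) (g @^-1` D).

Local Notation borelR := (measurableTypeR R).

(** Doob's factorization lemma, mod 0. A set that is not measurable may have a
negligible preimage under [g] without being negligible, so the measurability of
[F] cannot be read off [F \o g]: [F] is built from measurable sets. *)
Lemma coarser_mod0_factor d2 (T2 : measurableType d2)
    (f : T -> borelR) (g : T -> T2) :
  coarser_mod0 f g ->
  exists2 F : T2 -> borelR, measurable_fun setT F &
    \forall x \ae mu, F (g x) = f x.
Proof.
move=> fg.
(* An enumeration of the rationals, the default value 0 being harmless. *)
pose q (n : nat) : R := ratr (odflt 0 (unpickle n)).
have /choice[D HD] n : exists D, measurable D /\
    eq_mod0 mu (f @^-1` [set r | r < q n]) (g @^-1` D).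
  have [|D mD fgD] := fg [set r | r < q n]; last by exists D.
  by rewrite -set_itvE; exact: measurable_itv.
pose h n t : \bar R := if t \in D n then (q n)%:E else +oo%E.
have mh n : measurable_fun setT (h n).
  apply: measurable_fun_ifT => //; apply: (measurable_fun_bool true).
  rewrite setTI (_ : _ @^-1` _ = D n); first by case: (HD n).
  by apply/seteqP; split => t /=; [exact: set_mem|exact: mem_set].
(* The infimum is taken in the extended reals, where it is measurable and always
   exists; it is finite at almost every [g x]. *)
exists (fine \o (fun t => einfs (h ^~ t) 0)).
  exact: (measurableT_comp (fine_measurable measurableT) (measurable_fun_einfs mh 0)).
apply: (@negligibleS _ _ _ mu (\bigcup_n
    ((f @^-1` [set r | r < q n]) `+` (g @^-1` D n)))); last first.
  by apply: negligible_bigcup => n; case: (HD n).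
move=> x /= nx; apply: contrapT => nfg; apply: nx.
have fD n : (f x < q n) <-> D n (g x).
  split=> H; apply: contrapT => H'; apply: nfg; exists n => //.
    by left.
  by right.
suff -> : einfs (h ^~ (g x)) 0 = (f x)%:E by [].
rewrite /einfs; apply/eqP; rewrite eq_le; apply/andP; split.
  apply/lee_addgt0Pr => e e0.
  have /rat_in_itvoo[r] : f x < f x + e by rewrite ltrDl.
  rewrite in_itv/= => /andP[xr re].
  have qr : q (pickle r) = ratr r by rewrite /q pickleK.
  apply: (@le_trans _ _ (ratr r)%:E); last by rewrite -EFinD lee_fin ltW.
  apply: ereal_inf_lbound; exists (pickle r) => //=.
  by rewrite /h mem_set ?qr//; apply/fD; rewrite qr.
apply: le_ereal_inf_tmp => _ [n _ <-].
rewrite /h; case: ifPn => [|_]; last exact: leey.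
by rewrite inE => /fD fq; rewrite lee_fin ltW.
Qed.

(** Rokhlin's theorem for Borel measures on the line. *)
Lemma equivalent_factors_isomorphic (l1 l2 : {measure set borelR -> \bar R})
    (f g : T -> borelR) :
  measure_preserving_mod0 mu l1 f -> measure_preserving_mod0 mu l2 g ->
  coarser_mod0 f g -> coarser_mod0 g f -> isomorphic_mod0 l1 l2.
Proof.
move=> pf pg /coarser_mod0_factor[F mF Fgf] /coarser_mod0_factor[G mG Gfg].
have push (k1 k2 : {measure set borelR -> \bar R}) (u v : T -> borelR)
      (H : borelR -> borelR) :
    measure_preserving_mod0 mu k1 u -> measure_preserving_mod0 mu k2 v ->
    measurable_fun setT H -> (\forall x \ae mu, H (u x) = v x) ->
    measure_preserving_mod0 k1 k2 H.
  move=> pu pv mH Huv; apply: measure_preserving_mod0_measurable => // C mC.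
  have [B1 [mB1 uB1 <-]] := pu _ (measurable_preimage mH mC).
  have [B2 [mB2 vB2 <-]] := pv _ mC.
  apply: eq_mod0_measure => //.
  apply: eq_mod0_trans vB2; apply: eq_mod0_trans (eq_mod0_sym uB1) _.
  apply: negligibleS Huv => x /= HC Huvx; move: HC; rewrite Huvx.
  by case=> -[].
have inv (k : {measure set borelR -> \bar R}) (u v : T -> borelR)
      (H K : borelR -> borelR) :
    measure_preserving_mod0 mu k u -> measurable_fun setT H ->
    measurable_fun setT K -> (\forall x \ae mu, H (u x) = v x) ->
    (\forall x \ae mu, K (v x) = u x) -> \forall t \ae k, K (H t) = t.
  move=> pu mH mK Huv Kvu.
  pose E := [set t | K (H t) != t].
  have mE : measurable E.
    have mid : measurable_fun setT (fun t : borelR => t) by [].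
    have := measurable_fun_eqr (measurableT_comp mK mH) mid.
    move=> /(_ measurableT [set false]); rewrite setTI => /(_ I).
    by congr measurable; apply/seteqP; split => t; rewrite /E /=; case: eqP.
  apply: (@negligibleS _ _ _ _ E) => [t /= /eqP //|].
  apply/negligibleP => //; have [B [mB EB kE]] := pu _ mE.
  apply: etrans (esym kE) _.
  rewrite -(measure0 mu); apply: eq_mod0_measure => //.
  apply: eq_mod0_trans (eq_mod0_sym EB) _; rewrite /eq_mod0 setY0.
  apply: negligibleS (negligibleU Huv Kvu) => x /= /eqP KH.
  have [Hx|] := pselect (H (u x) = v x); [right => /= Kx|by left].
  by apply: KH; rewrite Hx.
exists G, F; split.
- exact: push pf pg mG Gfg.
- exact: push pg pf mF Fgf.
- exact: inv pf mG mF Gfg Fgf.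
- exact: inv pg mF mG Fgf Gfg.
Qed.

(** Two Lebesgue spaces are isomorphic mod 0 as soon as they are images of the
same measure under maps that generate the same sigma-algebra mod 0. *)
Theorem rokhlin_unique d1 d2 (T1 : measurableType d1) (T2 : measurableType d2)
    (n1 : {measure set T1 -> \bar R}) (n2 : {measure set T2 -> \bar R})
    (f : T -> T1) (g : T -> T2) :
  lebesgue_space n1 -> lebesgue_space n2 ->
  measure_preserving_mod0 mu n1 f -> measure_preserving_mod0 mu n2 g ->
  coarser_mod0 f g -> coarser_mod0 g f -> isomorphic_mod0 n1 n2.
Proof.
move=> [a1 [p1 iso1]] [a2 [p2 iso2]] pf pg fg gf.
apply: isomorphic_mod0_trans (iso1) _.
apply: isomorphic_mod0_trans _ (isomorphic_mod0_sym iso2).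
have [u1 [v1 [pu1 pv1 vu1 uv1]]] := iso1.
have [u2 [v2 [pu2 pv2 vu2 uv2]]] := iso2.
(* [coarser_mod0] is preserved when the values are transported to the line; the
   maps realizing the isomorphisms are measurable only mod 0. *)
have coarse d3 d4 (S1 : measurableType d3) (S2 : measurableType d4)
    (k1 : {measure set S1 -> \bar R}) (k2 : {measure set S2 -> \bar R})
    (l1 l2 : {measure set borelR -> \bar R})
    (u : borelR -> S2) (w1 : S1 -> borelR) (w2 : S2 -> borelR)
    (h1 : T -> S1) (h2 : T -> S2) :
    measure_preserving_mod0 mu k1 h1 -> measure_preserving_mod0 mu k2 h2 ->
    measure_preserving_mod0 k1 l1 w1 -> measure_preserving_mod0 l2 k2 u ->
    (\forall y \ae k2, u (w2 y) = y) ->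
    measure_preserving_mod0 k2 l2 w2 ->
    coarser_mod0 h1 h2 -> coarser_mod0 (w1 \o h1) (w2 \o h2).
  move=> ph1 ph2 pw1 pu uw2 pw2 h12 C mC.
  have [B [mB wCB _]] := pw1 _ mC.
  have [E mE BE] := h12 _ mB; have [D [mD uED _]] := pu _ mE.
  exists D => //.
  apply: eq_mod0_trans (eq_mod0_preimage ph1 wCB) _.
  apply: eq_mod0_trans BE _.
  apply: eq_mod0_trans _
    (eq_mod0_preimage (measure_preserving_mod0_comp ph2 pw2) uED).
  apply: negligibleS (negligible_preimage ph2 uw2) => x /= H uw; move: H.
  by rewrite uw => -[] [].
apply: (@equivalent_factors_isomorphic _ _ (u1 \o f) (u2 \o g)).
- exact: measure_preserving_mod0_comp pf pu1.
- exact: measure_preserving_mod0_comp pg pu2.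
- exact: coarse pf pg pu1 pv2 vu2 pu2 fg.
- exact: coarse pg pf pu2 pv1 vu1 pu1 gf.
Qed.

End rokhlin.

(** * Bernoulli measures *)

Section integral_indic_mulr.
Local Open Scope ereal_scope.
Context d (T : measurableType d) (R : realType).

Lemma integral_indic_mulr (mu : {measure set T -> \bar R}) A (c : \bar R) :
  measurable A -> 0 <= c -> \int[mu]_x ((\1_A x)%:E * c) = mu A * c.
Proof.
move=> mA c0; rewrite ge0_integralZr ?integral_indic ?setIT//.
by apply/measurable_EFinP; exact: measurable_indic.
Qed.

End integral_indic_mulr.

Section bernoulli.
Local Open Scope ereal_scope.
Context d (T : measurableType d) (R : realType).

Lemma measurable_path_shift :
  measurable_fun setT (@path_shift _ T).
Proof. by apply: measurable_path => n; exact: measurable_coord. Qed.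

Variables (m : probability T R) (B : probability (path_space T) R).
Hypothesis Bm : bernoulli_measure m B.

Lemma bernoulli_shift F : measurable F ->
  B (@path_shift _ T @^-1` F) = B F.
Proof.
move=> mF.
pose S : {mfun path_space T >-> path_space T} :=
  mfun_Sub (mem_set measurable_path_shift).
apply: (path_measure_unique (P := distribution B S)) => // n A mA.
pose A' i := if i is j.+1 then A j else setT.
have mA' i : measurable (A' i) by case: i => [|i]; [exact: measurableT|exact: mA].
transitivity (B (cylinder n.+2 A')).
  congr (B _); apply/seteqP; split => x /=; first by move=> Ax [|i] // /Ax.
  by move=> Ax i ilt; exact: (Ax i.+1).
rewrite [LHS](Bm _ mA') [RHS](Bm _ mA) big_ord_recl /= probability_setT mul1e.
by apply: eq_bigr.
Qed.

Lemma measurable_resample k F : measurable F ->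
  measurable_fun setT (fun w => m [set t | F (path_update k (w, t))]).
Proof.
move=> mF; rewrite (_ : (fun w => _) =
    m \o xsection ((@path_update _ T k) @^-1` F)); last first.
  by apply/funext => w; congr (m _); apply/seteqP; split => t;
    rewrite /xsection /= inE.
apply: measurable_fun_xsection; apply: measurable_preimage => //.
exact: measurable_path_update.
Qed.

(** A coordinate can be replaced by an independent one of law [m]: Fubini's
theorem then lets it be integrated separately. *)
Lemma bernoulli_resample_integral k (f : path_space T -> \bar R) :
  measurable_fun setT f -> (forall w, 0 <= f w) ->
  \int[B]_w f w = \int[B]_w \int[m]_t f (path_update k (w, t)).
Proof.
move=> mf f0.
pose U : {mfun (path_space T * T)%type >-> path_space T} :=
  mfun_Sub (mem_set (@measurable_path_update _ T k)).
rewrite [LHS](@eq_measure_integral _ _ _ _ (distribution (B \x m)%E U)).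
  rewrite ge0_integral_pushforward//.
  rewrite preimage_setT fubini_tonelli1//; last by move=> x; exact: f0.
  by apply: measurableT_comp mf _; exact: measurable_path_update.
move=> F mF _; rewrite [LHS](bernoulli_resample Bm k mF).
by apply: eq_integral => w _; congr (m _); apply/seteqP; split => t;
  rewrite /xsection /= inE.
Qed.

Lemma bernoulli_resample_negligible k N : B.-negligible N ->
  \forall w \ae B, m.-negligible [set t | N (path_update k (w, t))].
Proof.
move=> [M [mM M0 NM]].
have mf := measurable_resample k mM.
have : ae_eq B setT (fun w => m [set t | M (path_update k (w, t))]) (cst 0).
  apply/ae_eq_integral_abs => //.
  rewrite -[RHS]M0 (bernoulli_resample Bm k mM).
  by apply: eq_integral => w _; rewrite gee0_abs.
apply: filterS => w /(_ I) /= Mw.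
exists [set t | M (path_update k (w, t))]; split => //.
  apply: (measurable_preimage (f := fun t => path_update k (w, t))) => //.
  exact: measurableT_comp (measurable_path_update k) (measurable_pair1 w).
by move=> t /NM.
Qed.

Lemma path_update_cylinder n (A : nat -> set T) w t :
  cylinder n.+1 A (path_update n (w, t)) <-> cylinder n A w /\ A n t.
Proof.
split=> [wA|[wA tA] i /=].
  split=> [i ilt|]; last by have := wA n (ltnSn n); rewrite /path_update eqxx.
  by have := wA i (ltnW ilt); rewrite /path_update ltn_eqF.
rewrite ltnS leq_eqVlt /path_update => /orP[/eqP ->|ilt].
  by rewrite eqxx.
by rewrite ltn_eqF//; exact: wA.
Qed.

(** The Kolmogorov 0-1 law, for a set that need not be measurable: only the
invariance of [V] itself is exact, the measurable set [A] being invariant almost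
everywhere. *)
Theorem bernoulli_01 (V A : set (path_space T)) :
  (forall k w t, V (path_update k (w, t)) <-> V w) ->
  measurable A -> eq_mod0 B V A -> B A = 0 \/ B A = 1.
Proof.
move=> Vinv mA VA.
(* [A] is independent of every cylinder: the coordinates of the cylinder are
   resampled one at a time, which changes neither [V] nor, almost surely, [A]. *)
have indep n C : (forall i, measurable (C i)) ->
    B (A `&` cylinder n C) = B A * B (cylinder n C).
  move=> mC; rewrite [in RHS](Bm n mC); elim: n => [|n IH].
    rewrite big_ord0 mule1; congr (B _).
    by apply/seteqP; split => [x []//|x Ax]; split.
  have mcyl k : measurable (cylinder k C) by exact: measurable_cylinder.
  have mAC k : measurable (A `&` cylinder k C) by exact: measurableI.
  rewrite (bernoulli_resample Bm n (mAC n.+1)) big_ord_recr/= muleA -IH.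
  rewrite -integral_indic_mulr//.
  apply: ae_eq_integral => //.
  - exact: (measurable_resample n (mAC n.+1)).
  - apply: emeasurable_funM => //.
    by apply/measurable_EFinP; exact: measurable_indic.
  have VAw : \forall w \ae B, ~ (V `+` A) w.
    by apply: negligibleS VA => w /contrapT.
  move: VAw (bernoulli_resample_negligible n VA); apply: filterS2 => w nVA VAt _.
  have mu : measurable_fun setT (fun t => path_update n (w, t)).
    exact: measurableT_comp (measurable_path_update n) (measurable_pair1 w).
  rewrite indicE; case: (boolP (w \in A `&` cylinder n C)) => wA; rewrite ?mul1e ?mul0e.
    apply: eq_mod0_measure => //.
      exact: (measurable_preimage mu (mAC n.+1)).
    move: wA; rewrite inE => -[Aw Cw].
    have Vw : V w by apply: contrapT => nVw; apply: nVA; right.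
    apply: negligibleS VAt => t /= [[[_ Ct] nCt]|[Ct nAt]].
      by have [] := (path_update_cylinder _ _ _ _).1 Ct.
    left; split; first exact/Vinv.
    by move=> At; apply: nAt; split => //; exact/path_update_cylinder.
  rewrite -(measure0 m).
  apply: eq_mod0_measure => //.
    exact: (measurable_preimage mu (mAC n.+1)).
  rewrite /eq_mod0 setY0; apply: negligibleS VAt => t /= [At Ct].
  right; split => // /Vinv Vw; move: wA; rewrite notin_setE; apply.
  split; last by have [] := (path_update_cylinder _ _ _ _).1 Ct.
  by apply: contrapT => nAw; apply: nVA; left.
(* Cylinders being a pi-system, [A] is independent of itself. *)
have r0 : (0 <= fine (B A))%R by exact: fine_ge0.
have BAr : B A = (fine (B A))%:E by rewrite fineK// fin_num_measure.
pose B1 : {measure set (path_space T) -> \bar R} := mrestr B mA.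
pose B2 : {measure set (path_space T) -> \bar R} := mscale (NngNum r0) B.
have AA : B1 A = B2 A.
  refine (@measure_unique _ R _ (@cylinders _ T) (fun=> setT)
    _ _ _ _ B1 B2 _ _ A mA) => //.
  - exact: measurable_cylindersE.
  - exact: setI_closed_cylinders.
  - move=> _; exists (0%N, fun=> setT) => //=.
    by apply/seteqP; split.
  - by apply/seteqP; split => // x _; exists 0%N.
  - move=> _ [[n C] /= mC <-].
    by rewrite /B1 /B2 /= /mrestr /mscale/= -BAr setIC indep.
  - by move=> _; rewrite /B1 /= /mrestr setTI BAr ltry.
move: AA; rewrite /B1 /B2 /= /mrestr /mscale/= setIid BAr/= -EFinM => -[].
move: (fine (B A)) => r rr; have /eqP : (r * (r - 1) = 0)%R.
  by rewrite mulrBr mulr1 -rr subrr.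
by rewrite mulf_eq0 subr_eq0 => /orP[] /eqP ->; [left|right].
Qed.

End bernoulli.

Section zip.
Local Open Scope ereal_scope.
Context d1 d2 (T1 : measurableType d1) (T2 : measurableType d2) (R : realType).

(** A pair of paths as the path of the pairs. *)
Definition zip_path (p : path_space T1 * path_space T2) : path_space (T1 * T2)%type :=
  fun n => (p.1 n, p.2 n).

Lemma measurable_zip_path : measurable_fun setT zip_path.
Proof.
apply: measurable_path => n; apply/measurable_fun_pairP; split => /=.
  exact: measurableT_comp (measurable_coord n) measurable_fst.
exact: measurableT_comp (measurable_coord n) measurable_snd.
Qed.

Variables (m1 : probability T1 R) (m2 : probability T2 R).
Variables (B1 : probability (path_space T1) R) (B2 : probability (path_space T2) R).
Hypotheses (Bm1 : bernoulli_measure m1 B1) (Bm2 : bernoulli_measure m2 B2).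

(** On cylinders, the product of two Bernoulli measures is the Bernoulli measure of
the product. *)
Lemma bernoulli_zip n (A : nat -> set (T1 * T2)) : (forall i, measurable (A i)) ->
  (B1 \x B2) (zip_path @^-1` cylinder n A) = \prod_(i < n) (m1 \x m2) (A i).
Proof.
move=> mA; pose D k := zip_path @^-1` cylinder k A.
have mD k : measurable (D k).
  apply: measurable_preimage; first exact: measurable_zip_path.
  exact: measurable_cylinder.
have DS k w t v u : D k.+1 (path_update k (w, t), path_update k (v, u)) <->
    D k (w, v) /\ A k (t, u).
  have e : path_update k (zip_path (w, v), (t, u)) =
      zip_path (path_update k (w, t), path_update k (v, u)).
    by apply/funext => i; rewrite /zip_path /path_update /=; case: eqP.
  by have := path_update_cylinder k A (zip_path (w, v)) (t, u); rewrite e.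
rewrite -/(D n); elim: n => [|n IH].
  rewrite big_ord0 (_ : D 0%N = setT) ?probability_setT//.
  by apply/seteqP; split.
rewrite big_ord_recr/= -IH.
have mx k : measurable_fun setT (B2 \o xsection (D k)).
  exact: measurable_fun_xsection.
have mxA : measurable_fun setT (m2 \o xsection (A n)).
  exact: measurable_fun_xsection.
(* The last coordinate is resampled in both paths, and the integrals over the
   remaining coordinates are left as they are. *)
rewrite [LHS](bernoulli_resample_integral Bm1 n)//.
transitivity (\int[B1]_w ((B2 \o xsection (D n)) w * (m1 \x m2) (A n))); last first.
  by rewrite ge0_integralZr.
apply: eq_integral => w _.
rewrite [in RHS]/product_measure1 -ge0_integralZl//.
apply: eq_integral => t _ /=.
rewrite (bernoulli_resample Bm2 n); last exact: measurable_xsection.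
have mxD : measurable (xsection (D n) w) by exact: measurable_xsection.
rewrite -integral_indic_mulr//; apply: eq_integral => v _.
rewrite indicE; case: (boolP (v \in xsection (D n) w)) => vD; rewrite ?mul1e ?mul0e.
  congr (m2 _); apply/seteqP; split => u; rewrite /xsection /= !inE.
    by move=> /DS[].
  by move=> Au; apply/DS; split => //; move: vD; rewrite mem_xsection inE.
rewrite -(measure0 m2); congr (m2 _); apply/seteqP; split => u //=.
rewrite /xsection /= inE => /DS[Du _].
by move: vD; rewrite mem_xsection notin_setE; exact.
Qed.

End zip.

Section product.
Local Open Scope ereal_scope.
Context d1 d2 (T1 : measurableType d1) (T2 : measurableType d2) (R : realType).
Variables (m1 : probability T1 R) (m2 : probability T2 R).

Lemma product_measure_eq0P N : measurable N ->
  (m1 \x m2) N = 0 <-> \forall x \ae m1, m2 (xsection N x) = 0.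
Proof.
move=> mN; have mf : measurable_fun setT (m2 \o xsection N).
  exact: measurable_fun_xsection.
rewrite /product_measure1.
rewrite [X in X = _](_ : _ = \int[m1]_x `|(m2 \o xsection N) x|); last first.
  by apply: eq_integral => x _; rewrite gee0_abs.
rewrite ae_eq_integral_abs//; split; apply: filterS => x //=; exact.
Qed.

End product.

(** * The shift and its classes *)

Section tail.
Local Open Scope ereal_scope.
Context d (T : measurableType d).

Lemma path_equiv_shift (x : path_space T) : path_equiv x (path_shift x).
Proof. by exists 1%N, 0%N. Qed.

Lemma path_equiv_sym (x y : path_space T) : path_equiv x y -> path_equiv y x.
Proof. by move=> [k [l e]]; exists l, k. Qed.

Lemma iter_path_shift k (x : path_space T) n :
  iter k (@path_shift _ T) x n = x (k + n)%N.
Proof. by elim: k n => [//|k IH] n; rewrite iterS /path_shift IH addnS. Qed.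

(** The path equivalence is generated by the pairs formed by a path and its
shift. *)
Lemma union_of_classesP (U : set (path_space T)) :
  union_of_classes U <-> forall x, U x <-> U (path_shift x).
Proof.
split=> [HU x|HU x y [k [l e]] Ux].
  split; apply: HU; first exact: path_equiv_shift.
  exact/path_equiv_sym/path_equiv_shift.
have iterU n z : U z <-> U (iter n (@path_shift _ T) z).
  by elim: n => [//|n IH]; rewrite IH HU.
by apply: (iterU l y).2; rewrite -e; apply: (iterU k x).1.
Qed.

Lemma path_equiv_update k (w : path_space T) t :
  path_equiv (path_update k (w, t)) w.
Proof.
exists k.+1, k.+1; apply/funext => n; rewrite !iter_path_shift /path_update.
by rewrite gtn_eqF// addSn ltnS leq_addr.
Qed.

(** The path with first point [p.1] and shift [p.2]. *)
Definition path_cons (p : T * path_space T) : path_space T :=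
  fun n => if n is k.+1 then p.2 k else p.1.

Lemma measurable_path_cons : measurable_fun setT path_cons.
Proof.
apply: measurable_path => -[|n]; first exact: measurable_fst.
exact: measurableT_comp (measurable_coord n) measurable_snd.
Qed.

Context (R : realType) (m : probability T R) (Q : probability (path_space T) R).
Hypothesis Qm : bernoulli_measure m Q.

Lemma bernoulli_shift_mod0 : measure_preserving_mod0 Q Q (@path_shift _ T).
Proof.
apply: measure_preserving_mod0_measurable => [|C]; first exact: measurable_path_shift.
exact: (bernoulli_shift Qm).
Qed.

(** The direct implication is not formal, since [N] need not be measurable and the
image of a measurable set under the shift need not be measurable either. *)
Lemma bernoulli_shift_negligible (N : set (path_space T)) :
  Q.-negligible (@path_shift _ T @^-1` N) <-> Q.-negligible N.
Proof.
split=> [[M [mM M0 NM]]|]; last exact: (negligible_preimage bernoulli_shift_mod0).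
(* A measurable null set that contains [N]: the paths all of whose extensions
   by one point, up to an [m]-null set, lie in [M]. *)
pose C := path_cons @^-1` M.
have mC : measurable C by apply: measurable_preimage mM; exact: measurable_path_cons.
pose K := (m \o ysection C) @^-1` [set 1].
have mK : measurable K.
  apply: measurable_preimage; first exact: measurable_fun_ysection.
  exact: emeasurable_set1.
exists K; split => //.
  apply: etrans (esym (bernoulli_shift Qm mK)) _.
  apply: measure_negligible.
    by apply: measurable_preimage mK; exact: measurable_path_shift.
  have nM : Q.-negligible M by exists M; split.
  have := bernoulli_resample_negligible Qm 0 nM; apply: negligibleS => w Kw /=.
  move=> nMw; move: Kw; rewrite /K /=.
  have -> : ysection C (path_shift w) = [set t | M (path_update 0 (w, t))].
    apply/seteqP; split => t; rewrite /ysection /= inE /C /=;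
    rewrite (_ : path_cons _ = path_update 0 (w, t))//;
    by apply/funext => -[|n].
  rewrite measure_negligible//; first by move=> /esym/eqP; rewrite onee_eq0.
  apply: (measurable_preimage (f := fun t => path_update 0 (w, t))) => //.
  exact: measurableT_comp (measurable_path_update 0) (measurable_pair1 w).
move=> x Nx; rewrite /K /= (_ : ysection C x = setT) ?probability_setT//.
by apply/seteqP; split => t // _; rewrite /ysection /= inE; exact: NM.
Qed.

End tail.

(** * Extended paths as paths of the random walk with independent coordinates *)

Section random_walk.
Local Open Scope ereal_scope.
Variable G : groupType.
Hypothesis Gc : countable [set: G].
Local Notation dG := (discrete_group G).
Context (R : realType) d (X : measurableType d).
Local Notation E := (dG * X)%type.

Lemma measurable_walk :
  measurable_fun setT (@walk G : path_space dG -> path_space dG).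
Proof.
apply: measurable_path; elim=> [|n IH] /=; first exact: measurable_cst.
by apply: (measurable_mulg Gc) => //; exact: measurable_coord.
Qed.

(** The path [x] with its starting point replaced by the identity. *)
Definition rooted_path (x : path_space dG) : path_space dG :=
  fun n => if n is k.+1 then x n else 1%g.

(** The path of the random walk underlying an extended path. The identity is put
in front because extended paths start at time 1. *)
Definition group_path (y : path_space E) : path_space dG :=
  fun n => if n is k.+1 then (y k).1 else 1%g.

(** The X-coordinates of an extended path. *)
Definition space_path (y : path_space E) : path_space X := fun n => (y n).2.

(** The extended path with group component [p.1], without its starting point, and
X-coordinates [p.2]. *)
Definition join_path (p : path_space dG * path_space X) : path_space E :=
  zip_path (path_shift p.1, p.2).

Lemma rooted_walk h : rooted_path (walk h) = walk h.
Proof. by apply/funext => -[]. Qed.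

Lemma group_join_path p : group_path (join_path p) = rooted_path p.1.
Proof. by apply/funext => -[]. Qed.

Lemma measurable_group_path : measurable_fun setT group_path.
Proof.
apply: measurable_path => -[|n]; first exact: measurable_cst.
exact: measurableT_comp measurable_fst (measurable_coord n).
Qed.

Lemma measurable_space_path : measurable_fun setT space_path.
Proof.
apply: measurable_path => n.
exact: measurableT_comp measurable_snd (measurable_coord n).
Qed.

Lemma measurable_join_path : measurable_fun setT join_path.
Proof.
apply: measurableT_comp; first exact: measurable_zip_path.
apply/measurable_fun_pairP; split => /=; last exact: measurable_snd.
exact: measurableT_comp (@measurable_path_shift _ dG) measurable_fst.
Qed.

Lemma path_equiv_group_path y y' :
  path_equiv y y' -> path_equiv (group_path y) (group_path y').
Proof.
move=> [k [l e]]; exists k.+1, l.+1; apply/funext => n.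
rewrite !iter_path_shift !addSn /=.
by have := congr1 (fun f => (f n).1) e; rewrite !iter_path_shift.
Qed.

Variables (mu : probability dG R) (m : probability X R).
Variables (P : probability (path_space dG) R) (Pt : probability (path_space E) R).
Hypothesis P_law : random_walk_law mu P.
Hypothesis Pt_law : markov_chain_law (mu \x m) (extended_kernel mu m) Pt.

(** The law of the X-coordinates under [Pt]. *)
Definition space_law : probability (path_space X) R :=
  distribution Pt (mfun_Sub (mem_set measurable_space_path)).

Lemma space_law_bernoulli : bernoulli_measure m space_law.
Proof.
move=> n A mA.
pose A' i := [set: dG] `*` A i.
have mA' i : measurable (A' i) by exact: measurableX.
have muA' i : (mu \x m) (A' i) = m (A i).
  transitivity (mu setT * m (A i)); last by rewrite probability_setT mul1e.
  exact: (product_measure1E mu m measurableT (mA i)).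
have -> : space_law [set x | forall i, (i < n)%N -> A i (x i)] =
    Pt (cylinder n A').
  by congr (Pt _); apply/seteqP; split => y Ay i /Ay; [split|case].
elim: n => [|n IH].
  rewrite big_ord0 (_ : cylinder 0 A' = setT) ?probability_setT//.
  by apply/seteqP; split.
case: n IH => [_|n IH].
  rewrite big_ord1 -muA' -Pt_law.1//; congr (Pt _).
  by apply/seteqP; split => y; [exact|move=> ? []].
rewrite big_ord_recr/= -IH [LHS](Pt_law.2 n A' mA').
rewrite (eq_integral (cst (m (A n.+1)))).
  rewrite integral_cst; last exact: (measurable_cylinder n.+1 mA').
  exact: muleC.
move=> y _; rewrite (extended_kernelE Gc)// -muA'; congr ((mu \x m) _).
Qed.

Local Notation Q := space_law.

Lemma random_walk_rooted C : measurable C -> measurable (rooted_path @^-1` C) ->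
  P (rooted_path @^-1` C) = P C.
Proof.
move=> mC mrC; have [B _ PB] := P_law; rewrite !PB//.
by congr (B _); apply/seteqP; split => h /=; rewrite rooted_walk.
Qed.

Lemma random_walk_start : \forall x \ae P, rooted_path x = x.
Proof.
have [B _ PB] := P_law.
pose C := [set x : path_space dG | x 0%N = 1%g].
have mC : measurable C.
  exact: (measurable_preimage (C := [set (1%g : dG)]) (measurable_coord 0%N)).
have PC : P C = 1.
  by rewrite PB// (_ : _ @^-1` _ = setT) ?probability_setT//; apply/seteqP; split.
exists (~` C); split; first exact: measurableC.
  by rewrite probability_setC// PC subee.
by move=> x /= nx x0; apply: nx; apply/funext => -[|n] //=; rewrite x0.
Qed.

(** Under [Pt] the group component and the X-coordinates are independent, and the
former is the random walk without its starting point. *)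
Lemma extended_chain_joinE A : measurable A ->
  Pt A = (P \x Q) (join_path @^-1` A).
Proof.
move=> mA; have [B Bmu PB] := P_law.
pose Z : {mfun (path_space dG * path_space X)%type >-> path_space E} :=
  mfun_Sub (mem_set (@measurable_zip_path _ _ dG X)).
pose W : {mfun path_space dG >-> path_space dG} :=
  mfun_Sub (mem_set measurable_walk).
have ZB : bernoulli_measure (mu \x m) (distribution (B \x Q) Z).
  by move=> n C mC; exact: (bernoulli_zip Bmu space_law_bernoulli).
rewrite ((markov_chain_law_extended Gc ZB Pt).1 Pt_law A mA).
have mjA : measurable (join_path @^-1` A).
  by apply: measurable_preimage mA; exact: measurable_join_path.
rewrite /product_measure1.
rewrite [RHS](@eq_measure_integral _ _ _ _ (distribution B W)); last first.
  by move=> C mC _; exact: (PB C mC).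
by rewrite ge0_integral_pushforward//; exact: measurable_fun_xsection.
Qed.

Lemma join_path_mod0 : measure_preserving_mod0 (P \x Q) Pt join_path.
Proof.
apply: measure_preserving_mod0_measurable; first exact: measurable_join_path.
by move=> C mC; exact/esym/extended_chain_joinE.
Qed.

Lemma group_path_mod0 : measure_preserving_mod0 Pt P group_path.
Proof.
apply: measure_preserving_mod0_measurable; first exact: measurable_group_path.
move=> C mC.
have mr : measurable (rooted_path @^-1` C).
  apply: measurable_preimage mC; apply: measurable_path => -[|n].
    exact: measurable_cst.
  exact: measurable_coord.
have mg : measurable (group_path @^-1` C).
  by apply: measurable_preimage mC; exact: measurable_group_path.
apply: etrans (extended_chain_joinE mg) _.
apply: etrans _ (random_walk_rooted mC mr).
transitivity ((P \x Q) ((rooted_path @^-1` C) `*` setT)).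
  by congr ((P \x Q) _); apply/seteqP; split => p /=; rewrite group_join_path //; case.
transitivity (P (rooted_path @^-1` C) * Q setT); last by rewrite probability_setT mule1.
exact: (product_measure1E P Q mr measurableT).
Qed.

Lemma poisson_algebra_preimage A :
  poisson_algebra P A -> poisson_algebra Pt (group_path @^-1` A).
Proof.
move=> [mA [U clU AU]]; split.
  exact: (measurable_mod0_preimage group_path_mod0 mA).
exists (group_path @^-1` U); last exact: (eq_mod0_preimage group_path_mod0 AU).
by move=> y y' yy' Uy; exact: clU (path_equiv_group_path yy') Uy.
Qed.

(** The set of the paths over which [U] has a fibre of full measure. Here the path is
zipped without dropping its starting point, so that the shift of [x] and that
of the X-coordinates match. *)
Lemma fibre_union_of_classes (U : set (path_space E)) :
  union_of_classes U ->
  union_of_classes [set x : path_space dG |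
    Q.-negligible [set g | ~ U (zip_path (x, g))]].
Proof.
move=> /union_of_classesP HU; apply/union_of_classesP => x /=.
have e g : U (zip_path (x, g)) <-> U (zip_path (path_shift x, path_shift g)).
  exact: HU.
have -> : [set g | ~ U (zip_path (x, g))] =
    @path_shift _ X @^-1` [set g | ~ U (zip_path (path_shift x, g))].
  by apply/seteqP; split => g /= nU /e.
exact: (bernoulli_shift_negligible space_law_bernoulli).
Qed.

(** Every Poisson set of the extended chain comes, mod 0, from one of the random
walk. *)
Lemma poisson_algebra_descends A : poisson_algebra Pt A ->
  exists2 A0, poisson_algebra P A0 & eq_mod0 Pt A (group_path @^-1` A0).
Proof.
move=> [[B mB AB] [U clU AU]].
pose B' := join_path @^-1` B.
have mB' : measurable B' by apply: measurable_preimage mB; exact: measurable_join_path.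
pose V x := [set g | U (join_path (x, g))].
have UB : eq_mod0 (P \x Q) (join_path @^-1` U) B'.
  apply: (eq_mod0_preimage join_path_mod0).
  exact: eq_mod0_trans (eq_mod0_sym AU) AB.
have VB : \forall x \ae P, eq_mod0 Q (V x) (xsection B' x).
  have [N [mN N0 /= UBN]] := UB.
  have := (product_measure_eq0P P Q mN).1 N0; apply: filterS => x QN.
  exists (xsection N x); split => //; first exact: measurable_xsection.
  move=> g /= H; rewrite /xsection /= inE; apply: UBN.
  by move: H; rewrite /xsection /= inE.
have Q01 : \forall x \ae P, Q (xsection B' x) = 0 \/ Q (xsection B' x) = 1.
  move: VB; apply: filterS => x VBx.
  apply: (bernoulli_01 space_law_bernoulli _ _ VBx); last exact: measurable_xsection.
  have eqv k w t : path_equiv (join_path (x, path_update k (w, t)))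
      (join_path (x, w)).
    have -> : join_path (x, path_update k (w, t)) =
        path_update k (join_path (x, w), (x k.+1, t)).
      apply/funext => i; rewrite /join_path /zip_path /path_update /=.
      by case: eqP => // ->.
    exact: path_equiv_update.
  move=> k w t; split; apply: clU; first exact: eqv.
  exact/path_equiv_sym/eqv.
(* The paths whose fibre has full measure, in a measurable version. *)
pose A0 := (Q \o xsection B') @^-1` [set 1].
have mA0 : measurable A0.
  apply: measurable_preimage; first exact: measurable_fun_xsection.
  exact: emeasurable_set1.
have mx x : measurable (xsection B' x) by exact: measurable_xsection.
have QC x : Q (xsection B' x) = 1 <-> Q.-negligible (~` xsection B' x).
  have QCE : Q (~` xsection B' x) = 1 - Q (xsection B' x).
    exact: probability_setC.
  split=> [Q1|nC].
    apply/negligibleP; first exact: measurableC.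
    by apply: etrans QCE _; rewrite Q1 subee.
  have : 1 - Q (xsection B' x) = 0.
    rewrite -QCE; apply: measure_negligible nC; exact: measurableC.
  have : Q (xsection B' x) \is a fin_num by exact: fin_num_measure.
  by case: (Q _) => // r _ /eqP; rewrite -EFinB eqe subr_eq0 => /eqP <-.
exists A0; first split.
- by exists A0 => //; exact: eq_mod0_refl.
- exists [set x | Q.-negligible [set g | ~ U (zip_path (x, g))]].
    exact: fibre_union_of_classes.
  have clU0 := (union_of_classesP _).1 (fibre_union_of_classes clU).
  apply: negligibleS VB => x /= AU0 VBx.
  have : A0 x <-> Q.-negligible [set g | ~ U (zip_path (x, g))].
    rewrite [X in _ <-> X]clU0 /A0 /= QC.
    split=> n; apply: negligibleS (negligibleU n VBx) => g /=.
      move=> nU; have [Bg|] := pselect (xsection B' x g); [right; right|left] => //.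
    move=> nB; have [Ug|] := pselect (V x g); [right; left|left] => //.
  by move: AU0 => -[[A0x nU]|[Ux nA0]] e; [apply/nU/e|apply/nA0/e].
apply: eq_mod0_trans AB _.
have mg : measurable (group_path @^-1` A0).
  by apply: measurable_preimage mA0; exact: measurable_group_path.
have mD : measurable (B `+` group_path @^-1` A0).
  by apply: measurableU; apply: measurableD.
apply/negligibleP => //; apply: etrans (extended_chain_joinE mD) _.
apply/product_measure_eq0P.
  by apply: measurable_preimage mD; exact: measurable_join_path.
move: Q01 random_walk_start; apply: filterS2 => x Qx x0.
have -> : xsection (join_path @^-1` (B `+` group_path @^-1` A0)) x =
    xsection B' x `+` [set _ | A0 x].
  apply/seteqP; split => g; rewrite /xsection /setY /= !inE /= group_join_path /= x0.
    by [].
  by [].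
case: Qx => Qx.
  rewrite (_ : [set _ | _] = set0) ?setY0//.
  by apply/seteqP; split => g //=; rewrite /A0 /= Qx => /eqP; rewrite eq_sym onee_eq0.
rewrite (_ : [set _ | _] = setT); last by apply/seteqP; split.
by rewrite setYTC probability_setC// Qx subee.
Qed.

End random_walk.

(** * The two Poisson boundaries *)

Theorem proposition3p1 (R : realType)
  (G : groupType) (G_countable : countable [set: G])
  (mu : probability (discrete_group G) R) (mu_gen : generates (mu_support mu))
  (d : measure_display) (X : measurableType d) (m : probability X R)
  (X_lebesgue : lebesgue_space m)
  (P : probability (path_space (discrete_group G)) R)
  (P_law : random_walk_law mu P)
  (Pt : probability (path_space (discrete_group G * X)%type) R)
  (Pt_law : markov_chain_law (mu \x m)%E (extended_kernel mu m) Pt)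
  (d1 : measure_display) (Gamma : measurableType d1)
  (nu : probability Gamma R)
  (bnd : path_space (discrete_group G) -> Gamma)
  (Gamma_bnd : is_poisson_boundary P nu bnd)
  (d2 : measure_display) (Gammat : measurableType d2)
  (nut : probability Gammat R)
  (bndt : path_space (discrete_group G * X)%type -> Gammat)
  (Gammat_bnd : is_poisson_boundary Pt nut bndt) :
  isomorphic_mod0 nu nut.
Proof.
have [L1 pbnd PbndE] := Gamma_bnd; have [L2 pbndt PbndtE] := Gammat_bnd.
have pgroup := group_path_mod0 G_countable P_law Pt_law.
apply: (rokhlin_unique L1 L2 (measure_preserving_mod0_comp pgroup pbnd) pbndt).
- move=> C mC; apply/PbndtE.
  apply: (poisson_algebra_preimage G_countable P_law Pt_law (A := bnd @^-1` C)).
  by apply/PbndE; exists C => //; exact: eq_mod0_refl.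
- move=> C mC.
  have [|A0 pA0 CA0] := poisson_algebra_descends G_countable P_law Pt_law
      (A := bndt @^-1` C).
    by apply/PbndtE; exists C => //; exact: eq_mod0_refl.
  have [D mD A0D] := (PbndE A0).1 pA0; exists D => //.
  exact: eq_mod0_trans CA0 (eq_mod0_preimage pgroup A0D).
Qed.
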